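(* Let $r\ge 2$ and $s\ge 1$ be integers. For every integer $k\geq r$, $$A_k(x,t)=\frac{\bar{\alpha}(x,t)A_{k-1}^{\geq r-1}(tx,t)+\bar{\beta}_k(x,t)}{\bar{\gamma}(x,t)A_{k-1}^{\geq r-1}(tx,t)+\bar{\delta}_k(x,t)},$$ where $\bar{\alpha}(x,t)=1/t^{s-1}$, $\bar{\gamma}(x,t)=-(r-1)x/t^{s-1}$, and $$\bar{\beta}_k(x,t)=\frac{1-(kx)^{s}}{1-kx}-\frac{1-((k-r+1)tx)^{s}}{t^{s-1}(1-(k-r+1)tx)}-\frac{(r-1)x}{1-kx}\left(\frac{1-((k-r+1)x)^{s-1}}{1-(k-r+1)x}-(kx)^{s-1}\,\frac{1-\left(\frac{k-r+1}{k}\right)^{s-1}}{1-\frac{k-r+1}{k}}\right),$$ $$\bar{\delta}_k(x,t)=1-\frac{(r-1)x(1-((k-r+1)x)^{s-1})}{1-(k-r+1)x}+\frac{(r-1)x(1-((k-r+1)tx)^{s-1})}{t^{s-1}(1-(k-r+1)tx)}.$$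
   Context: For a word $w=w_1\cdots w_n$ of positive integers, its bargraph consists of $n$ consecutive columns of unit cells, aligned at the bottom, the $i$-th column having height $w_i$. An occurrence of an $r\times s$ rectangle in $w$ is a placement of a rectangle of height $r$ and width $s$ (with sides along the unit grid) inside the bargraph. Equivalently, the number of occurrences is $\sum_{i=1}^{n-s+1}\max\{\min\{w_i,\ldots,w_{i+s-1}\}-r+1,0\}$ (which is $0$ if $n<s$). For $n\ge 0$ let $\mathcal{W}_{n,k}=\{1,\ldots,k\}^n$ be the set of words of length $n$ over $\{1,\ldots,k\}$ (for $n=0$ only the empty word), let $a_{n,k}(t)=\sum_{w\in\mathcal{W}_{n,k}}t^{(\text{number of occurrences of } r\times s\text{ rectangles in } w)}$, and let $A_k(x,t)=\sum_{n\ge 0}a_{n,k}(t)x^n$. For $m\ge r-1$ and $n\ge 0$, let $\mathcal{W}_{n,m}^{\ge r-1}$ be the set of words of length $n$ all of whose letters lie in $\{r-1,r,\ldots,m\}$, let $a_{n,m}^{\ge r-1}(t)=\sum_{w\in\mathcal{W}_{n,m}^{\ge r-1}}t^{(\text{number of occurrences of } r\times s\text{ rectangles in } w)}$, and let $A_m^{\ge r-1}(x,t)=\sum_{n\ge 0}a_{n,m}^{\ge r-1}(t)x^n$. Identities are between formal power series in $x$ with coefficients in $\mathbb{Q}(t)$. *)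

(* Defs.v *)
From HB Require Import structures.
From mathcomp Require Import all_boot all_order all_algebra.
From mathcomp Require Import ring zify.
From mathcomp Require boolp.

Set Implicit Arguments.
Unset Strict Implicit.
Unset Printing Implicit Defensive.

Import GRing.Theory.
Local Open Scope ring_scope.

Record fps (R : Type) := FPS { fps_coef :> nat -> R }.

Lemma fpsP (R : Type) (f g : fps R) : f =1 g <-> f = g.
Proof.
split=> [|-> //]; case: f g => [f] [g] /= fg.
by congr FPS; apply: boolp.funext.
Qed.

HB.instance Definition _ (R : Type) := boolp.gen_eqMixin (fps R).
HB.instance Definition _ (R : Type) := boolp.gen_choiceMixin (fps R).

Section FpsRing.
Variable R : comUnitRingType.
Implicit Types (f g h : fps R) (n : nat).

Definition fpsC (c : R) : fps R := FPS (fun n => if n == 0%N then c else 0).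
Definition fpsX : fps R := FPS (fun n => (n == 1%N)%:R).

Definition fps_opp f := FPS (fun n => - f n).
Definition fps_add f g := FPS (fun n => f n + g n).
Definition fps_mul f g := FPS (fun n => \sum_(i < n.+1) f i * g (n - i)%N).

Fact fps_addA : associative fps_add.
Proof. by move=> f g h; apply/fpsP => n /=; rewrite addrA. Qed.
Fact fps_addC : commutative fps_add.
Proof. by move=> f g; apply/fpsP => n /=; rewrite addrC. Qed.
Fact fps_add0 : left_id (fpsC 0) fps_add.
Proof. by move=> f; apply/fpsP => n /=; rewrite if_same add0r. Qed.
Fact fps_addN : left_inverse (fpsC 0) fps_opp fps_add.
Proof. by move=> f; apply/fpsP => n /=; rewrite if_same addNr. Qed.

HB.instance Definition _ :=
  GRing.isZmodule.Build (fps R) fps_addA fps_addC fps_add0 fps_addN.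

Definition fps_trunc n f : {poly R} := \poly_(i < n) f i.

Lemma fps_mul_trunc N n f g : (n < N)%N ->
  fps_mul f g n = (fps_trunc N f * fps_trunc N g)`_n.
Proof.
move=> nN; rewrite coefM /=; apply: eq_bigr => i _.
rewrite !coef_poly (leq_ltn_trans (leq_subr _ _) nN).
by rewrite (leq_ltn_trans _ nN) // -ltnS.
Qed.

Fact fps_mulC : commutative fps_mul.
Proof.
by move=> f g; apply/fpsP => n; rewrite !(fps_mul_trunc _ _ (ltnSn n)) mulrC.
Qed.

Fact fps_mulA : associative fps_mul.
Proof.
move=> f g h; apply/fpsP => n.
pose tr := fps_trunc n.+1.
transitivity (tr f * (tr g * tr h))`_n; last rewrite mulrA.
  rewrite coefM; apply: eq_bigr => i _.
  by rewrite coef_poly ltn_ord -(@fps_mul_trunc n.+1) // ltnS leq_subr.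
rewrite coefM; apply: eq_bigr => i _.
by rewrite -(@fps_mul_trunc n.+1) // coef_poly ltnS leq_subr.
Qed.

Fact fps_mul1 : left_id (fpsC 1) fps_mul.
Proof.
move=> f; apply/fpsP => n /=.
rewrite big_ord_recl /= subn0 mul1r big1 ?addr0 // => i _.
by rewrite mul0r.
Qed.

Fact fps_mulDl : left_distributive fps_mul fps_add.
Proof.
move=> f g h; apply/fpsP => n /=.
by rewrite -big_split; apply: eq_bigr => i _; rewrite mulrDl.
Qed.

Fact fps_1_neq0 : fpsC 1 != 0.
Proof. by apply/eqP => /fpsP/(_ 0) /= /eqP; rewrite oner_eq0. Qed.

HB.instance Definition _ :=
  GRing.Zmodule_isComNzRing.Build (fps R)
    fps_mulA fps_mulC fps_mul1 fps_mulDl fps_1_neq0.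

(* The first n coefficients of the inverse of f, obtained by solving
   \sum_(i <= m) f_(m - i) g_i = [m = 0] successively for the g_m. *)
Fixpoint fps_inv_seq f n : seq R :=
  if n is m.+1 then
    let s := fps_inv_seq f m in
    rcons s ((f 0%N)^-1 * ((m == 0%N)%:R - \sum_(i < m) f (m - i)%N * s`_i))
  else [::].

Definition fps_unit : pred (fps R) := fun f => f 0%N \is a GRing.unit.
Definition fps_inv f :=
  if fps_unit f then FPS (fun n => (fps_inv_seq f n.+1)`_n) else f.

Lemma size_fps_inv_seq f n : size (fps_inv_seq f n) = n.
Proof. by elim: n => //= n IHn; rewrite size_rcons IHn. Qed.

Lemma nth_fps_inv_seq f n i : (i < n)%N ->
  (fps_inv_seq f n)`_i = (fps_inv_seq f i.+1)`_i.
Proof.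
elim: n => // n IHn; rewrite ltnS leq_eqVlt => /predU1P[-> //|lt_in].
by rewrite [LHS]/= nth_rcons size_fps_inv_seq lt_in IHn.
Qed.

Fact fps_mulV f : fps_unit f -> fps_mul (fps_inv f) f = fpsC 1.
Proof.
move=> Uf; rewrite /fps_inv Uf; apply/fpsP => n.
change (\sum_(i < n.+1) (fps_inv_seq f i.+1)`_i * f (n - i)%N = fpsC 1 n).
rewrite big_ord_recr subnn /=.
rewrite [X in _ + X * _]nth_rcons size_fps_inv_seq ltnn eqxx.
rewrite [X in _ + X]mulrC mulVKr //.
rewrite [X in X + _](_ : _ = \sum_(i < n) f (n - i)%N * (fps_inv_seq f n)`_i).
  by rewrite addrC subrK /=; case: eqP.
by apply: eq_bigr => i _; rewrite mulrC -(nth_fps_inv_seq _ (ltn_ord i)).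
Qed.

Fact fps_unitPl f g : fps_mul g f = fpsC 1 -> fps_unit f.
Proof.
move=> /fpsP/(_ 0) /=; rewrite big_ord_recl big_ord0 addr0 /= => gf1.
by apply/unitrPr; exists (g 0); rewrite mulrC.
Qed.

Fact fps_inv_out : {in [predC fps_unit], fps_inv =1 id}.
Proof.
move=> f nUf; rewrite /fps_inv; case: ifP => // Uf.
by move: nUf; rewrite inE -topredE /= Uf.
Qed.

HB.instance Definition _ :=
  GRing.ComNzRing_hasMulInverse.Build (fps R) fps_mulV fps_unitPl fps_inv_out.

Lemma fps_unitE f : (f \is a GRing.unit) = (f 0%N \is a GRing.unit).
Proof. by []. Qed.

Fact fps_coef0_is_zmod_morphism : zmod_morphism (fun f => f 0%N).
Proof. by []. Qed.
Fact fps_coef0_is_monoid_morphism : monoid_morphism (fun f => f 0%N).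
Proof. by split=> // f g /=; rewrite big_ord_recl big_ord0 addr0. Qed.

Definition fps_coef0 f := f 0%N.
HB.instance Definition _ :=
  GRing.isZmodMorphism.Build (fps R) R fps_coef0 fps_coef0_is_zmod_morphism.
HB.instance Definition _ :=
  GRing.isMonoidMorphism.Build (fps R) R fps_coef0 fps_coef0_is_monoid_morphism.

Lemma fps_coef0X : fps_coef0 fpsX = 0.
Proof. by []. Qed.

(* f(c x) *)
Definition fps_dilate (c : R) f := FPS (fun n => c ^+ n * f n).

End FpsRing.

(* A placement is given by the 0-based column i and row j of the lower left
   cell of the rectangle.  For r, s >= 1 the bounds on i and j hold for every
   rectangle that fits. *)
Definition fits (r s : nat) (w : seq nat) (i j : nat) : bool :=
  (i + s <= size w)%N && all (fun h => j + r <= h)%N (take s (drop i w)).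

Definition occurrences (r s : nat) (w : seq nat) : nat :=
  #|[set p : 'I_(size w) * 'I_(\max_(h <- w) h) | fits r s w p.1 p.2]|.

Definition window_min (s : nat) (w : seq nat) (i : nat) : nat :=
  \big[minn/nth 0%N w i]_(h <- take s (drop i w)) h.

Lemma occurrencesE r s w : (0 < r)%N -> (0 < s)%N ->
  occurrences r s w =
  (\sum_(i < (size w).+1 - s) ((window_min s w i).+1 - r))%N.
Proof.
move=> r_gt0 s_gt0; rewrite /occurrences; set M := \max_(h <- w) h.
have fitsE i j : (i + s <= size w)%N ->
    fits r s w i j = (j < (window_min s w i).+1 - r)%N.
  move=> le_is; rewrite /fits le_is ltn_subRL [(r + j)%N]addnC ltnS /window_min.
  have lt_iw: (i < size w)%N by rewrite (leq_trans _ le_is) // -addn1 leq_add2l.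
  have allE x u : all (fun h => j + r <= h)%N u && (j + r <= x)%N
                  = (j + r <= \big[minn/x]_(h <- u) h)%N.
    by elim: u => [|h u IHu]; rewrite ?big_nil // big_cons leq_min -IHu andbA.
  rewrite -allE -(prednK s_gt0) (drop_nth 0%N) //=.
  by case: (_ <= nth 0%N w i)%N; rewrite ?andbT.
have wminM i : (i + s <= size w)%N -> (window_min s w i <= M)%N.
  move=> le_is; have lt_iw: (i < size w)%N.
    by rewrite (leq_trans _ le_is) // -addn1 leq_add2l.
  have le_xM: (nth 0%N w i <= M)%N.
    by rewrite /M (big_nth 0%N) big_mkord (bigmax_sup (Ordinal lt_iw)).
  rewrite /window_min; elim/big_rec: _ => // h m _ le_mM.
  by rewrite geq_min le_mM orbT.
rewrite cardsE -sum1_card.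
rewrite (eq_bigl (fun p : 'I_(size w) * 'I_M => true && fits r s w p.1 p.2)) //.
rewrite -(pair_big_dep xpredT
            (fun (i : 'I_(size w)) (j : 'I_M) => fits r s w i j) (fun _ _ => 1%N)) /=.
transitivity (\sum_(i < size w | (i + s <= size w)%N) ((window_min s w i).+1 - r))%N.
  rewrite [RHS]big_mkcond /=; apply: eq_bigr => i _; case: ifPn => [le_is|nle].
    rewrite (eq_bigl _ _ (fun j : 'I_M => fitsE i j le_is)).
    have le_M: ((window_min s w i).+1 - r <= M)%N.
      by rewrite leq_subLR (leq_ltn_trans (wminM _ le_is)) // -add1n leq_add2r.
    by rewrite -(big_ord_widen _ (fun=> 1%N)) // sum1_card card_ord.
  by rewrite big_pred0 // => j; rewrite /fits (negPf nle).
have le_sz: ((size w).+1 - s <= size w)%N by rewrite leq_subLR -add1n leq_add2r.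
rewrite (big_ord_widen _ (fun i => (window_min s w i).+1 - r)%N le_sz).
by apply: eq_bigl => i; rewrite ltn_subRL ltnS addnC.
Qed.

(* Q(t) and its generator t *)
Definition Qt : fieldType := {fraction {poly rat}}.
Definition tvar : Qt := tofrac 'X.

Definition words (l m n : nat) : {set n.-tuple 'I_m.+1} :=
  [set w : n.-tuple 'I_m.+1 | all (fun c : 'I_m.+1 => l <= c)%N w].

(* \sum_n x^n \sum_w t^(occurrences r s w), w ranging over the words of
   length n with letters in {l, ..., m} *)
Definition words_gf (r s l m : nat) : fps Qt :=
  FPS (fun n => \sum_(w in words l m n)
         tvar ^+ occurrences r s [seq val c | c <- w]).

Definition A (r s k : nat) : fps Qt := words_gf r s 1 k.
Definition A_ge (r s m : nat) : fps Qt := words_gf r s (r - 1) m.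

Section Coefficients.
Variables r s k : nat.
Let x : fps Qt := fpsX Qt.
Let t : fps Qt := fpsC tvar.

Definition alpha_bar : fps Qt := 1 / t ^+ (s - 1).

Definition gamma_bar : fps Qt := - ((r - 1)%:R * x / t ^+ (s - 1)).

Definition beta_bar : fps Qt :=
  (1 - (k%:R * x) ^+ s) / (1 - k%:R * x)
  - (1 - ((k - r + 1)%:R * t * x) ^+ s)
      / (t ^+ (s - 1) * (1 - (k - r + 1)%:R * t * x))
  - (r - 1)%:R * x / (1 - k%:R * x)
    * ((1 - ((k - r + 1)%:R * x) ^+ (s - 1)) / (1 - (k - r + 1)%:R * x)
       - (k%:R * x) ^+ (s - 1)
         * ((1 - ((k - r + 1)%:R / k%:R) ^+ (s - 1))
              / (1 - (k - r + 1)%:R / k%:R))).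

Definition delta_bar : fps Qt :=
  1 - (r - 1)%:R * x * (1 - ((k - r + 1)%:R * x) ^+ (s - 1))
        / (1 - (k - r + 1)%:R * x)
    + (r - 1)%:R * x * (1 - ((k - r + 1)%:R * t * x) ^+ (s - 1))
        / (t ^+ (s - 1) * (1 - (k - r + 1)%:R * t * x)).

End Coefficients.

(* All divisions above, and the one by
   gamma_bar * A_ge(t x) + delta_bar, are by units. *)
Lemma fps_natr_unit n : ((n%:R : fps Qt) \is a GRing.unit) = (n != 0%N).
Proof.
rewrite fps_unitE -[_ 0]/(fps_coef0 n%:R) rmorph_nat unitfE.
by rewrite -(rmorph_nat (@tofrac {poly rat})) tofrac_eq0 -polyC_natr polyC_eq0
           Num.Theory.pnatr_eq0.
Qed.

Lemma fpsC_tvar_unit : (fpsC tvar : fps Qt) \is a GRing.unit.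
Proof. by rewrite fps_unitE /= unitfE tofrac_eq0 polyX_eq0. Qed.

Lemma fps_1subX_unit (f : fps Qt) : 1 - f * fpsX Qt \is a GRing.unit.
Proof.
rewrite fps_unitE -[_ 0]/(fps_coef0 (1 - f * fpsX Qt)) rmorphB rmorphM rmorph1.
by rewrite [X in _ * X]fps_coef0X mulr0 subr0 unitr1.
Qed.

Lemma ratio_unit r k : (2 <= r <= k)%N ->
  (1 - (k - r + 1)%:R / k%:R : fps Qt) \is a GRing.unit.
Proof.
move=> /andP[r2 rk]; have k0: (k%:R : fps Qt) \is a GRing.unit.
  by rewrite fps_natr_unit -lt0n (leq_trans _ rk) // ltnW.
have [m_lt_k m_le_k] : (k - r + 1 < k /\ k - r + 1 <= k)%N by lia.
have aux (R : comUnitRingType) (a b : R) : b \is a GRing.unit ->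
    (1 - a / b \is a GRing.unit) = (b - a \is a GRing.unit).
  move=> Ub; rewrite -(unitrMl (b - a) (etrans (unitrV b) Ub)) mulrBl.
  by rewrite (divrr Ub).
by rewrite (aux _ _ _ k0) -(natrB _ m_le_k) fps_natr_unit -lt0n subn_gt0.
Qed.

Lemma denominator_unit r s k :
  gamma_bar r s * fps_dilate tvar (A_ge r s (k - 1)) + delta_bar r s k
    \is a GRing.unit.
Proof.
rewrite /gamma_bar /delta_bar; set x := fpsX Qt; set c := (r - 1)%:R.
have aux (p q u v p' u' : fps Qt) :
    - (c * x * p) * q + (1 - c * x * u * v + c * x * u' * p')
    = 1 - (c * (p * q + u * v - u' * p')) * x.
  by ring.
by rewrite aux fps_1subX_unit.
Qed.

(* Main.v *)
Require Import Defs.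
From HB Require Import structures.
From mathcomp Require Import all_boot all_order all_algebra.
From mathcomp Require Import ring zify.

Set Implicit Arguments.
Unset Strict Implicit.
Unset Printing Implicit Defensive.

Import GRing.Theory.
Local Open Scope ring_scope.

(** Every word over {1, ..., k} factors uniquely as a word u over
    {r, ..., k}, possibly followed by a letter c < r and an arbitrary word v.
    A rectangle of height r cannot cover the column of c, so that the
    occurrences in u c v are those in u together with those in v
    ([occurrences_cat]).  Writing U for the generating function of the words
    over {r, ..., k}, this is the renewal equation
      A_k = U + (r - 1) x U A_k                               ([A_renewal]),
    that is, A_k = U / (1 - (r - 1) x U).

    Adding 1 to every letter of a word of length n over {r - 1, ..., k - 1}
    raises the minimum of each window of s columns by 1.  These minima are at
    least r - 1, so max(min - r + 1, 0) is just min - r + 1 before and after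
    the shift: each window gains exactly one occurrence ([occurrences_lift]),
    and there are max(n + 1 - s, 0) windows.
    Hence t^(s-1) U and A_(k-1)^(>= r-1)(t x) have the same coefficients in
    degrees n >= s - 1, while for n < s a word contains no window and
    the discrepancy is a difference of two truncated geometric series in
    q x and q t x, with q = k - r + 1 letters available ([words_gf_lift]).

    Solving for U expresses A_k as a fraction linear in A_(k-1)^(>= r-1)(t x),
    with denominator 1 - (r - 1) x U and numerator U.  The coefficient beta_k
    contains a sum over powers of k x and a correction; together they amount to
    the sum of the powers of q x ([geo_sum_change]). *)

(** * Sums over words *)

Section SumWords.
Variable V : nmodType.
Implicit Types (S L H : seq nat) (F G : seq nat -> V).

(** The sum of F over S^n, letter by letter: unlike a sum over tuples, it
    recurses on the first letter without any reindexing. *)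
Fixpoint sum_words S n F : V :=
  if n is n'.+1 then \sum_(c <- S) sum_words S n' (fun w => F (c :: w))
  else F [::].

Lemma eq_sum_words S n F G :
  (forall w, size w = n -> all [in S] w -> F w = G w) ->
  sum_words S n F = sum_words S n G.
Proof.
elim: n F G => [|n IHn] F G eqFG /=; first exact: eqFG.
apply: eq_big_seq => c cS; apply: IHn => w szw wS.
by apply: eqFG; rewrite /= ?szw ?cS.
Qed.

Lemma sum_words_map (h : nat -> nat) S n F :
  sum_words (map h S) n F = sum_words S n (fun w => F (map h w)).
Proof.
elim: n F => [|n IHn] F //=.
by rewrite big_map; apply: eq_bigr => c _; rewrite IHn.
Qed.

(** Words are sorted by the position i of their first letter in L, if any.
    F is arbitrary so that the induction can absorb the letters already
    read. *)
Lemma sum_words_first_letter L H n F :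
  sum_words (L ++ H) n F =
  sum_words H n F +
  \sum_(i < n) sum_words H i (fun u =>
     \sum_(c <- L) sum_words (L ++ H) (n.-1 - i) (fun v => F (u ++ c :: v))).
Proof.
elim: n F => [|n IHn] F /=; first by rewrite big_ord0 addr0.
rewrite big_cat /= big_ord_recl /= subn0 [RHS]addrCA; congr (_ + _).
under eq_bigr do rewrite IHn.
rewrite big_split /=; congr (_ + _).
rewrite exchange_big /=; apply: eq_bigr => i _; apply: eq_bigr => c _.
have -> // : (n.-1 - i = n - bump 0 i)%N.
by rewrite /bump /=; lia.
Qed.

Lemma sum_words_tuple l m n F :
  \sum_(w in words l m n) F [seq val c | c <- w]
  = sum_words (index_iota l m.+1) n F.
Proof.
elim: n F => [|n IHn] F.
  by rewrite (big_pred1 [tuple]) // => w; rewrite tuple0 inE /= [RHS]eqxx.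
pose cons_word (p : 'I_m.+1 * n.-tuple 'I_m.+1) := cons_tuple p.1 p.2.
have cons_word_bij : bijective cons_word.
  exists (fun w => (thead w, behead_tuple w)) => [[c w]|w].
    by congr pair; apply: val_inj.
  by apply: val_inj; case/tupleP: w.
rewrite (reindex cons_word) /=; last exact: onW_bij.
rewrite (eq_bigl (fun p : 'I_m.+1 * n.-tuple 'I_m.+1 =>
                    (l <= p.1)%N && (p.2 \in words l m n))); last first.
  by move=> [c w]; rewrite !inE.
rewrite -(pair_big_dep (fun c : 'I_m.+1 => (l <= c)%N)
            (fun _ w => w \in words l m n)
            (fun c w => F (val c :: [seq val d | d <- w]))) /=.
rewrite big_geq_mkord; apply: eq_bigr => c _.
exact: (IHn (fun w => F (val c :: w))).
Qed.

End SumWords.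

Section SumWordsRing.
Variable R : comNzRingType.
Implicit Types (S : seq nat) (F G : seq nat -> R).

Lemma sum_wordsMl S n F a :
  a * sum_words S n F = sum_words S n (fun w => a * F w).
Proof.
elim: n F => [|n IHn] F //=.
by rewrite mulr_sumr; apply: eq_bigr => c _; rewrite IHn.
Qed.

Lemma sum_words1 S n : sum_words S n (fun=> 1 : R) = (size S)%:R ^+ n.
Proof.
elim: n => [|n IHn] //=; rewrite big_const_seq count_predT IHn exprS.
by rewrite iter_addr_0 mulr_natl.
Qed.

(** A weight that is multiplicative at the letters of L turns the
    classification by the first such letter into a convolution. *)
Lemma sum_words_split L H n F :
  F [::] = 1 ->
  (forall c u v, c \in L -> F (u ++ c :: v) = F u * F v) ->
  sum_words (L ++ H) n F =
  sum_words H n F +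
  \sum_(i < n) sum_words H i F
     * ((size L)%:R * sum_words (L ++ H) (n.-1 - i) F).
Proof.
move=> F0 FM; rewrite sum_words_first_letter; congr (_ + _).
apply: eq_bigr => i _; set a := (size L)%:R * _.
rewrite [RHS]mulrC sum_wordsMl.
apply: eq_sum_words => u _ _.
rewrite (eq_big_seq (fun=> F u * sum_words (L ++ H) (n.-1 - i) F)).
  by rewrite big_const_seq count_predT iter_addr_0 /a; ring.
move=> c cL; rewrite sum_wordsMl; apply: eq_sum_words => v _ _.
exact: FM.
Qed.

End SumWordsRing.

(** * Occurrences of rectangles *)

Section Occurrences.
Variables r s : nat.
Hypotheses (r_gt0 : (0 < r)%N) (s_gt0 : (0 < s)%N).
Implicit Types (u v w : seq nat).

(** The rectangles whose leftmost column is the first column of w. *)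
Definition front_occ w : nat :=
  if (s <= size w)%N then ((\big[minn/head 0%N w]_(h <- take s w) h).+1 - r)%N
  else 0%N.

Lemma bigmin_le (x c : nat) w : c \in w -> (\big[minn/x]_(h <- w) h <= c)%N.
Proof.
elim: w => // a w IHw; rewrite inE big_cons geq_min.
by case/predU1P => [->|/IHw ->]; rewrite ?leqnn ?orbT.
Qed.

Lemma front_occ0 w c : c \in take s w -> (c < r)%N -> front_occ w = 0%N.
Proof.
move=> cw cr; rewrite /front_occ; case: ifP => // _.
by have := bigmin_le (head 0%N w) cw; lia.
Qed.

Lemma occurrences_sum w :
  occurrences r s w = (\sum_(i < size w) front_occ (drop i w))%N.
Proof.
have le_sz : ((size w).+1 - s <= size w)%N by lia.
rewrite occurrencesE // (big_ord_widen _ (fun i => (window_min s w i).+1 - r)%N le_sz).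
rewrite big_mkcond; apply: eq_bigr => i _; rewrite /front_occ size_drop.
have -> : (s <= size w - i)%N = (i < (size w).+1 - s)%N by lia.
by rewrite /window_min -nth0 nth_drop addn0.
Qed.

Lemma occurrences_cons c w :
  occurrences r s (c :: w) = (front_occ (c :: w) + occurrences r s w)%N.
Proof. by rewrite !occurrences_sum big_ord_recl drop0. Qed.

Lemma occurrences_nil : occurrences r s [::] = 0%N.
Proof. by rewrite occurrences_sum big_ord0. Qed.

(** A window at the start of u ++ c :: v either lies inside u or contains the
    column of c, which is too low for a rectangle. *)
Lemma front_occ_cat u c v : (c < r)%N ->
  front_occ (u ++ c :: v) = front_occ u.
Proof.
move=> cr; case: (leqP s (size u)) => [le_su|lt_us].
  rewrite /front_occ size_cat takel_cat // le_su (leq_trans le_su (leq_addr _ _)).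
  by case: u le_su => //=; lia.
rewrite (@front_occ0 _ c) //; first by rewrite /front_occ leqNgt lt_us.
rewrite take_cat ltnNge (ltnW lt_us) /= mem_cat.
by case: (s - size u)%N (subn_gt0 (size u) s) => [|d _]; rewrite ?lt_us // inE eqxx orbT.
Qed.

Lemma occurrences_cat u c v : (c < r)%N ->
  occurrences r s (u ++ c :: v) = (occurrences r s u + occurrences r s v)%N.
Proof.
move=> cr; elim: u => [|a u IHu] /=.
  by rewrite occurrences_cons (front_occ_cat [::]) // occurrences_nil
             /front_occ leqn0 (gtn_eqF s_gt0).
by rewrite !occurrences_cons IHu -cat_cons front_occ_cat // addnA.
Qed.

Lemma front_occ_lift w : all (fun h => r.-1 <= h)%N w ->
  front_occ (map S w) = (front_occ w + (s <= size w))%N.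
Proof.
move=> w_ge; rewrite /front_occ size_map; case: ifP => // le_sw.
have -> : head 0%N (map S w) = (head 0%N w).+1 by case: w le_sw {w_ge} => //=; lia.
rewrite -map_take big_map -(big_morph S (fun a b => esym (minnSS a b)) (erefl _)).
suff : (r.-1 <= \big[minn/head 0%N w]_(h <- take s w) h)%N by lia.
rewrite big_seq; elim/big_rec: _ => [|h m hw m_ge].
  by case: w w_ge le_sw => [|a w] /=; [lia | case/andP].
by rewrite leq_min m_ge andbT; apply: (allP w_ge); apply: mem_take hw.
Qed.

(** Each of the windows gains one occurrence.  The bound on the letters is
    sharp: a window with minimum below r - 1 would gain none. *)
Lemma occurrences_lift w : all (fun h => r.-1 <= h)%N w ->
  occurrences r s (map S w) = (occurrences r s w + ((size w).+1 - s))%N.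
Proof.
elim: w => [|a w IHw]; first by rewrite /= occurrences_nil; lia.
move=> aw_ge; have /andP[_ /IHw w_occ] := aw_ge.
rewrite map_cons !occurrences_cons -map_cons front_occ_lift // w_occ /=.
by case: leqP; lia.
Qed.

Lemma occurrences_short w : (size w < s)%N -> occurrences r s w = 0%N.
Proof. by move=> lt_ws; rewrite occurrencesE // (_ : _ - _ = 0)%N ?big_ord0 //; lia. Qed.

End Occurrences.

(** * Coefficients of power series *)

Section FpsCoef.
Variable R : comUnitRingType.
Implicit Types (f g : fps R).

Lemma fpsCM_coef c f n : (fpsC c * f) n = c * f n.
Proof.
rewrite [LHS]big_ord_recl /= subn0 big1 ?addr0 // => i _.
by rewrite mul0r.
Qed.

Lemma fpsXM_coef f n : (fpsX R * f) n = if n is m.+1 then f m else 0.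
Proof.
case: n => [|n]; first by rewrite [LHS]big_ord_recl big_ord0 /= mul0r addr0.
rewrite [LHS]big_ord_recl big_ord_recl /= mul0r add0r mul1r big1 ?addr0 ?subn1 //.
by move=> i _; rewrite mul0r.
Qed.

Lemma fps_dilate_coef c f n : fps_dilate c f n = c ^+ n * f n.
Proof. by []. Qed.

Fact fpsC_zmod_morphism : zmod_morphism (@fpsC R).
Proof. by move=> a b; apply/fpsP => -[|n] //=; rewrite subr0. Qed.
Fact fpsC_monoid_morphism : monoid_morphism (@fpsC R).
Proof.
by split=> // a b; apply/fpsP => n; rewrite fpsCM_coef /=; case: n => //=; rewrite mulr0.
Qed.
HB.instance Definition _ :=
  GRing.isZmodMorphism.Build R (fps R) (@fpsC R) fpsC_zmod_morphism.
HB.instance Definition _ :=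
  GRing.isMonoidMorphism.Build R (fps R) (@fpsC R) fpsC_monoid_morphism.

Lemma fpsCX_exp_coef c i n : ((fpsC c * fpsX R) ^+ i) n = (n == i)%:R * c ^+ n.
Proof.
elim: i n => [|i IHi] n.
  by rewrite expr0; case: n => [|n] /=; rewrite ?mul0r ?mulr1 // mulr1.
rewrite exprS -mulrA fpsCM_coef fpsXM_coef; case: n => [|n]; first by rewrite mulr0 mul0r.
by rewrite IHi eqSS exprS; ring.
Qed.

Lemma fps_sum_coef (I : Type) (l : seq I) (F : I -> fps R) n :
  (\sum_(i <- l) F i) n = \sum_(i <- l) F i n.
Proof.
elim: l => [|i l IHl]; first by rewrite !big_nil /= if_same.
by rewrite !big_cons -IHl.
Qed.

Lemma fps_geo_coef c m n :
  (\sum_(i < m) (fpsC c * fpsX R) ^+ i) n = if (n < m)%N then c ^+ n else 0.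
Proof.
rewrite fps_sum_coef; under eq_bigr do rewrite fpsCX_exp_coef.
case: ltnP => [lt_nm|le_mn].
  rewrite (bigD1 (Ordinal lt_nm)) //= eqxx mul1r big1 ?addr0 // => i.
  by rewrite -val_eqE /= eq_sym => /negPf ->; rewrite mul0r.
by rewrite big1 // => i _; rewrite gtn_eqF ?mul0r // (leq_trans _ le_mn).
Qed.

Lemma geo_sum (S : comUnitRingType) (y : S) m : 1 - y \is a GRing.unit ->
  \sum_(i < m) y ^+ i = (1 - y ^+ m) / (1 - y).
Proof.
move=> Uy; apply: (mulIr Uy).
by rewrite divrK // -[RHS]opprB subrX1 -mulNr opprB mulrC.
Qed.

End FpsCoef.

(** * Generating functions *)

Section GeneratingFunctions.
Variables r s : nat.
Hypotheses (r_gt0 : (0 < r)%N) (s_gt0 : (0 < s)%N).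

Local Notation x := (fpsX Qt).
Local Notation t := (fpsC tvar).
Local Notation weight := (fun w => tvar ^+ occurrences r s w).

Lemma words_gf_coef l m n :
  words_gf r s l m n = sum_words (index_iota l m.+1) n weight.
Proof. exact: sum_words_tuple. Qed.

(** The last factor stands for the part of the word after the first letter
    below r, and (r - 1) x for that letter. *)
Lemma A_renewal k : (r <= k.+1)%N ->
  A r s k = words_gf r s r k + (r - 1)%:R * x * (words_gf r s r k * A r s k).
Proof.
move=> le_rk; apply/fpsP => n; rewrite -[RHS]/(_ n + _ n) -mulrA.
rewrite -(rmorph_nat (@fpsC Qt)) fpsCM_coef fpsXM_coef !words_gf_coef.
have letters_split : index_iota 1 k.+1 = index_iota 1 r ++ index_iota r k.+1.
  by rewrite /index_iota -[X in _ ++ iota X _](subnKC r_gt0) -iotaD; congr iota; lia.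
rewrite letters_split sum_words_split; first 1 last.
- by rewrite occurrences_nil.
- by move=> c u v; rewrite mem_index_iota => /andP[_ cr]; rewrite occurrences_cat // exprD.
congr (_ + _); case: n => [|n]; first by rewrite big_ord0 mulr0.
rewrite mulr_sumr; apply: eq_bigr => i _.
by rewrite !words_gf_coef -letters_split size_iota mulrCA.
Qed.

(** In degrees n < s - 1 the lift multiplies the weight by t^0 where the
    dilation expects t^(n - (s - 1)); there all words have weight 1, which gives
    the two geometric sums.  In degree s - 1 their terms cancel, so the sums may
    as well stop at s - 2. *)
Lemma words_gf_lift l m : (r.-1 <= l)%N ->
  t ^+ (s - 1) * words_gf r s l.+1 m.+1 =
  fps_dilate tvar (words_gf r s l m)
  + (t ^+ (s - 1) * \sum_(i < s) ((m.+1 - l)%:R * x) ^+ i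
     - \sum_(i < s) ((m.+1 - l)%:R * t * x) ^+ i).
Proof.
move=> le_rl; apply/fpsP => n; rewrite -[RHS]/(_ n + (_ n - _ n)).
rewrite -(rmorph_nat (@fpsC Qt)) -rmorphXn -rmorphM !fpsCM_coef !fps_geo_coef.
rewrite fps_dilate_coef !words_gf_coef.
have -> : index_iota l.+1 m.+2 = map S (index_iota l m.+1).
  by rewrite /index_iota subSS -[l.+1]add1n iotaDl.
rewrite sum_words_map (@eq_sum_words _ _ _ _
  (fun w => tvar ^+ (n.+1 - s) * tvar ^+ occurrences r s w)); last first.
  move=> w <- w_in; rewrite occurrences_lift // ?exprD 1?mulrC //.
  by apply: sub_all w_in => c /=; rewrite mem_index_iota => /andP[/(leq_trans le_rl)].
(* The degrees n >= s need no correction; n = s - 1 is treated with the small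
   ones. *)
rewrite -sum_wordsMl; case: ltnP => [lt_ns|le_sn]; last first.
  rewrite mulr0 subrr addr0 mulrA -exprD; congr (_ ^+ _ * _); lia.
rewrite (@eq_sum_words _ _ _ _ (fun=> 1)); last first.
  by move=> w szw _; rewrite occurrences_short ?szw.
rewrite sum_words1 size_iota exprMn.
have -> : (n.+1 - s = 0)%N by lia.
by ring.
Qed.

End GeneratingFunctions.

(** * The coefficients of the fraction *)

(** Since a^n - b^n = (a - b) sum_(i + j = n - 1) a^i b^j, summing over n first
    gives sum_n (a^n - b^n) = (a - b) sum_j b^j (1 - a^(m-j)) / (1 - a), where
    b^j a^(m-j) = a^m rho^j.  Here a is k x, b is q x and rho is q / k. *)
Lemma geo_sum_change (R : comUnitRingType) (a b rho : R) m :
  1 - a \is a GRing.unit -> 1 - b \is a GRing.unit ->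
  1 - rho \is a GRing.unit -> b = rho * a ->
  (1 - a ^+ m.+1) / (1 - a)
  - (a - b) / (1 - a)
    * ((1 - b ^+ m) / (1 - b) - a ^+ m * ((1 - rho ^+ m) / (1 - rho)))
  = (1 - b ^+ m.+1) / (1 - b).
Proof.
move=> Ua Ub Urho def_b.
have telescope : (a - b) * (a ^+ m * ((1 - rho ^+ m) / (1 - rho)))
                 = a * (a ^+ m - b ^+ m).
  transitivity (a * (a ^+ m - rho ^+ m * a ^+ m) * ((1 - rho) / (1 - rho))).
    by rewrite def_b; ring.
  by rewrite divrr // mulr1 def_b exprMn.
apply: (mulIr Ua).
transitivity ((1 - a ^+ m.+1 - (a - b) * ((1 - b ^+ m) / (1 - b))
   + (a - b) * (a ^+ m * ((1 - rho ^+ m) / (1 - rho)))) * ((1 - a) / (1 - a))).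
  by ring.
rewrite telescope divrr // mulr1; apply: (mulIr Ub).
rewrite [RHS]mulrAC divrK //.
transitivity ((1 - a ^+ m.+1 + a * (a ^+ m - b ^+ m)) * (1 - b)
              - (a - b) * (1 - b ^+ m) * ((1 - b) / (1 - b))); first by ring.
by rewrite divrr // !exprS; ring.
Qed.

(** The renewal equation and the lift, in an arbitrary ring, determine the
    fraction: A, U and D play the roles of A_k, of the series of the words over
    {r, ..., k} and of A_(k-1)^(>= r-1)(t x), and c that of r - 1. *)
Lemma renewal_fraction (R : comUnitRingType) (A U D x t k q c : R) m :
  t \is a GRing.unit -> k \is a GRing.unit -> 1 - q / k \is a GRing.unit ->
  1 - k * x \is a GRing.unit -> 1 - q * x \is a GRing.unit ->
  1 - q * t * x \is a GRing.unit -> c = k - q ->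
  A = U + c * x * (U * A) ->
  t ^+ m * U = D + (t ^+ m * \sum_(i < m.+1) (q * x) ^+ i
                    - \sum_(i < m.+1) (q * t * x) ^+ i) ->
  let num := 1 / t ^+ m * D
    + ((1 - (k * x) ^+ m.+1) / (1 - k * x)
       - (1 - (q * t * x) ^+ m.+1) / (t ^+ m * (1 - q * t * x))
       - c * x / (1 - k * x)
         * ((1 - (q * x) ^+ m) / (1 - q * x)
            - (k * x) ^+ m * ((1 - (q / k) ^+ m) / (1 - q / k)))) in
  let den := - (c * x / t ^+ m) * D
    + (1 - c * x * (1 - (q * x) ^+ m) / (1 - q * x)
       + c * x * (1 - (q * t * x) ^+ m) / (t ^+ m * (1 - q * t * x))) in
  den \is a GRing.unit -> A = num / den.
Proof.
move=> Ut' Uk Urho Ukx Uqx Uqtx cE renewal lift num den Uden.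
have Ut : t ^+ m \is a GRing.unit by rewrite unitrX.
have D_scaled : (t ^+ m)^-1 * D
  = U - \sum_(i < m.+1) (q * x) ^+ i
    + (t ^+ m)^-1 * \sum_(i < m.+1) (q * t * x) ^+ i.
  by apply: (mulrI Ut); rewrite mulrDr mulrBr !mulVKr // lift; ring.
have num_eq : num = U.
  have cx_eq : c * x = k * x - q * x by rewrite cE mulrBl.
  have q_eq : q * x = q / k * (k * x) by rewrite mulrA divrK.
  rewrite /num div1r D_scaled cx_eq.
  have := geo_sum_change m Ukx Uqx Urho q_eq.
  by rewrite !geo_sum // invrM // => change; rewrite -change; ring.
have den_eq : den = 1 - c * x * U.
  transitivity (1 - c * x * ((t ^+ m)^-1 * D
    + (1 - (q * x) ^+ m) / (1 - q * x)
    - (1 - (q * t * x) ^+ m) / (t ^+ m * (1 - q * t * x)))); first by rewrite /den; ring.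
  (* The sums in [D_scaled] have degree m, those in den degree m - 1; the two
     terms of degree m cancel. *)
  have top_eq : (t ^+ m)^-1 * (q * t * x) ^+ m = (q * x) ^+ m.
    by rewrite mulrAC exprMn [_ * t ^+ m]mulrC mulKr.
  rewrite D_scaled !big_ord_recr /= [_^-1 * (_ + _)]mulrDr top_eq.
  by rewrite !geo_sum // invrM //; ring.
apply: (mulIr Uden); rewrite divrK // num_eq den_eq.
by rewrite mulrBr mulr1 [X in X - _]renewal; ring.
Qed.

Theorem theorem4 (r s : nat) (hr : (2 <= r)%N) (hs : (1 <= s)%N)
  (k : nat) (hk : (r <= k)%N) :
  A r s k =
    (alpha_bar s * fps_dilate tvar (A_ge r s (k - 1)) + beta_bar r s k)
    / (gamma_bar r s * fps_dilate tvar (A_ge r s (k - 1)) + delta_bar r s k).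
Proof.
have r_gt0 : (0 < r)%N by lia.
case: s hs => // m hs; have s_eq : (m.+1 - 1 = m)%N by lia.
have den_unit := denominator_unit r m.+1 k.
have le_r : (r.-1 <= r - 1)%N by lia.
have [r_eq k_eq] : (r - 1).+1 = r /\ (k - 1).+1 = k by lia.
have lift := @words_gf_lift r m.+1 r_gt0 hs _ (k - 1) le_r.
have renewal := @A_renewal r m.+1 r_gt0 hs k (leqW hk).
have q_eq : (k - (r - 1) = k - r + 1)%N by lia.
rewrite r_eq k_eq q_eq s_eq in lift.
rewrite /gamma_bar /delta_bar s_eq in den_unit *.
rewrite /alpha_bar /beta_bar s_eq.
apply: renewal_fraction renewal lift den_unit.
- exact: fpsC_tvar_unit.
- by rewrite fps_natr_unit; lia.
- by apply: ratio_unit; lia.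
- exact: fps_1subX_unit.
- exact: fps_1subX_unit.
- exact: fps_1subX_unit.
- by rewrite -natrB; [congr _%:R; lia | lia].
Qed.
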